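(* Let $a\le 0$ be an integer. Define $a_{\mathcal{M}}(n)$, $n\ge 0$, by $a_{\mathcal{M}}(0)=1$, $a_{\mathcal{M}}(1)=-1$, $a_{\mathcal{M}}(2)=a$ and, for $n\ge3$, $a_{\mathcal{M}}(n)=-\frac{1}{2}\sum_{k=0}^{n-1}a_{\mathcal{M}}(k)\binom{n}{k}2^{n-k}$. For integers $0\le j\le d$ set $$c_{\mathcal{M}}(j,d)=\sum_{k=j}^d2^{-k}\binom{d-j}{d-k}a_{\mathcal{M}}(k).$$ Then for all $d\ge 0$ and $0\le j\le d$, $c_{\mathcal{M}}(j,d)=(-1)^dc_{\mathcal{M}}(d-j,d)$. *)

(* Defs.v *)
From mathcomp Require Import all_boot all_order all_algebra.

Set Implicit Arguments.
Unset Strict Implicit.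
Unset Printing Implicit Defensive.

Import Order.TTheory GRing.Theory Num.Theory.
Local Open Scope ring_scope.

Definition is_aM (a : int) (aM : nat -> rat) : Prop :=
  [/\ aM 0%N = 1, aM 1%N = -1, aM 2%N = a%:~R
    & forall n : nat, (3 <= n)%N ->
        aM n = - (1 / 2) * \sum_(0 <= k < n) aM k * ('C(n, k))%:R * 2 ^+ (n - k)].

Definition cM (aM : nat -> rat) (j d : nat) : rat :=
  \sum_(j <= k < d.+1) 2 ^- k * ('C(d - j, d - k))%:R * aM k.

(* [is_aM a] is satisfied by exactly one sequence: [is_aM_exists] and
   [is_aM_unique] below. *)
Fixpoint aM_list (a : int) (n : nat) : seq rat :=
  if n is m.+1 then
    let s := aM_list a m in
    rcons s
      (match m with
       | 0%N => 1
       | 1%N => -1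
       | 2 => a%:~R
       | _ => - (1 / 2) *
                \sum_(0 <= k < m) s`_k * ('C(m, k))%:R * 2 ^+ (m - k)
       end)
  else [::].

Lemma size_aM_list (a : int) (n : nat) : size (aM_list a n) = n.
Proof. by elim: n => //= n IHn; rewrite size_rcons IHn. Qed.

Lemma nth_aM_list (a : int) (m n : nat) :
  (m < n)%N -> (aM_list a n)`_m = (aM_list a m.+1)`_m.
Proof.
elim: n => // n IHn; rewrite ltnS leq_eqVlt => /orP[/eqP-> //|lt_mn].
by rewrite [aM_list a n.+1]/= nth_rcons size_aM_list lt_mn IHn.
Qed.

Lemma is_aM_exists (a : int) : exists aM : nat -> rat, is_aM a aM.
Proof.
exists (fun n => (aM_list a n.+1)`_n); split=> // n n_ge3.
rewrite [aM_list a n.+1 in LHS]/= nth_rcons size_aM_list ltnn eqxx.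
case: n n_ge3 => [|[|[|n]]] // _; congr (_ * _).
by apply: eq_big_nat => k /andP[_ lt_kn]; rewrite nth_aM_list.
Qed.

Lemma is_aM_unique (a : int) (f g : nat -> rat) :
  is_aM a f -> is_aM a g -> f =1 g.
Proof.
move=> [f0 f1 f2 fr] [g0 g1 g2 gr] n.
elim/ltn_ind: n => -[|[|[|n]]] IHn; rewrite ?f0 ?g0 ?f1 ?g1 ?f2 ?g2 //.
rewrite fr // gr //; congr (_ * _).
by apply: eq_big_nat => k /andP[_ lt_kn]; rewrite IHn.
Qed.

(* Main.v *)
Require Import Defs.
From HB Require Import structures.
From mathcomp Require Import all_boot all_order all_algebra.
From mathcomp Require Import ring.

Import Order.TTheory GRing.Theory Num.Theory.
Local Open Scope ring_scope.

(** Let L be the linear functional on polynomials with L(X^k) = 2^-k a_M(k).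
    The recurrence says that L(X^n) + L((1 + X)^n) vanishes for every odd n
    (indeed unless n = 0 or n = 2).  The functional p |-> L(p(-1 - X)) satisfies
    the same relation with the same right-hand sides, and such a relation
    determines a functional, so L(p) = L(p(-1 - X)).  As
    c_M(j, d) = L(X^j (1 + X)^(d - j)), this is the claimed symmetry. *)

Definition umbral (R : comNzRingType) (b : nat -> R) (p : {poly R}) : R :=
  \sum_(i < size p) p`_i * b i.

Arguments umbral {R} b p.

Section Umbral.
Variables (R : comNzRingType) (b : nat -> R).

(** A summation bound independent of [p] puts polynomials of different sizes over one index range,
    as linearity requires. *)
Lemma umbral_widen n (p : {poly R}) :
  (size p <= n)%N -> umbral b p = \sum_(i < n) p`_i * b i.
Proof.
move=> le_pn; rewrite /umbral (big_ord_widen n (fun i => p`_i * b i)) //.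
rewrite big_mkcond; apply: eq_bigr => i _.
by case: ltnP => // le_pi; rewrite nth_default // mul0r.
Qed.

Lemma umbral_is_linear : linear_for *%R (umbral b).
Proof.
move=> c p q; pose n := maxn (size p) (size q).
have le_pn : (size p <= n)%N by rewrite leq_maxl.
have le_qn : (size q <= n)%N by rewrite leq_maxr.
rewrite !(umbral_widen n) //; last first.
  rewrite (leq_trans (size_polyD _ _)) // geq_max le_qn.
  by rewrite (leq_trans (size_scale_leq _ _)).
rewrite mulr_sumr -big_split; apply: eq_bigr => i _ /=.
by rewrite coefD coefZ mulrDl mulrA.
Qed.

HB.instance Definition _ :=
  GRing.isLinear.Build R {poly R} R *%R (umbral b) umbral_is_linear.

Lemma umbralXn n : umbral b 'X^n = b n.
Proof.
rewrite (umbral_widen n.+1) ?size_polyXn // big_ord_recr /= coefXn eqxx mul1r.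
rewrite big1 ?add0r // => i _.
by rewrite coefXn ltn_eqF ?mul0r.
Qed.

Lemma umbral_Xn_X1n j m :
  umbral b ('X^j * (1 + 'X) ^+ m) = \sum_(i < m.+1) 'C(m, i)%:R * b (j + i)%N.
Proof.
rewrite exprDn mulr_sumr linear_sum; apply: eq_bigr => i _ /=.
by rewrite expr1n mul1r mulrnAr raddfMn /= -exprD umbralXn mulr_natl.
Qed.

End Umbral.

Lemma umbral_reflect (R : numDomainType) (b : nat -> R) :
  (forall n, odd n -> b n + \sum_(k < n.+1) 'C(n, k)%:R * b k = 0) ->
  forall p : {poly R}, umbral b (p \Po (- 1 - 'X)) = umbral b p.
Proof.
move=> b_odd p; set N : {poly R} := - 1 - 'X.
have binL n (q : {poly R}) : umbral b ((1 + q) ^+ n) =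
    \sum_(k < n.+1) 'C(n, k)%:R * umbral b (q ^+ k).
  rewrite exprDn linear_sum; apply: eq_bigr => k _ /=.
  by rewrite expr1n mul1r raddfMn mulr_natl.
have signL n (q : {poly R}) :
    umbral b ((- q) ^+ n) = (-1) ^+ n * umbral b (q ^+ n).
  by rewrite (exprNn q) -linearZ /= -mul_polyC rmorphXn /= rmorphN1.
pose D n := b n - umbral b (N ^+ n).
(* Since [N] is [- (1 + 'X)] and [1 + N] is [- 'X], the left side is [1 - (-1) ^+ n] times
   [b n + umbral b ((1 + 'X) ^+ n)]: zero for even [n], twice the hypothesis for odd [n]. *)
have recD n : D n + \sum_(k < n.+1) 'C(n, k)%:R * D k = 0.
  have -> : \sum_(k < n.+1) 'C(n, k)%:R * D k =
      umbral b ((1 + 'X) ^+ n) - umbral b ((1 + N) ^+ n).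
    rewrite !binL -sumrB; apply: eq_bigr => k _.
    by rewrite umbralXn -mulrBr.
  have -> : 1 + N = - 'X by rewrite /N; ring.
  have NE : N = - (1 + 'X) by rewrite /N; ring.
  rewrite /D NE !signL umbralXn -signr_odd.
  case: (boolP (odd n)) => [odd_n|_]; last by rewrite expr0; ring.
  have := b_odd n odd_n; under eq_bigr do rewrite -umbralXn.
  by rewrite -binL expr1 => b0; rewrite -[0](mulr0 2) -b0; ring.
(* By induction only the top term of the sum survives, leaving [2 * D n = 0]. *)
have D0 n : D n = 0.
  elim/ltn_ind: n => n IHn; have := recD n.
  rewrite big_ord_recr /= big1 => [|k _]; last by rewrite IHn ?mulr0.
  rewrite binn mul1r add0r -mulr2n => /eqP.
  by rewrite mulrn_eq0 => /eqP.
rewrite comp_polyE linear_sum; apply: eq_bigr => i _ /=.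
by rewrite linearZ /=; congr (_ * _); apply/esym/subr0_eq/D0.
Qed.

Lemma cM_umbral (aM : nat -> rat) (d j : nat) : (j <= d)%N ->
  cM aM j d = umbral (fun k => 2 ^- k * aM k) ('X^j * (1 + 'X) ^+ (d - j)).
Proof.
move=> le_jd; rewrite umbral_Xn_X1n /cM -{1}[j]add0n big_addn big_mkord.
rewrite subSn //; apply: eq_bigr => i _.
have le_id : (i <= d - j)%N by rewrite -ltnS.
(* With [k = i + j], the symmetry of binomials turns ['C(d - j, d - k)] into ['C(d - j, i)]. *)
by rewrite -(bin_sub le_id) -subnDA [(i + j)%N]addnC -mulrA mulrCA.
Qed.

(** For [n >= 3] this is the recurrence divided by [2 ^+ n], the two copies of the top term
    absorbing the factor [1 / 2]; [n = 1] follows from the initial values. *)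
Lemma is_aM_odd (a : int) (aM : nat -> rat) : is_aM a aM ->
  forall n, odd n -> 2 ^- n * aM n +
    \sum_(k < n.+1) 'C(n, k)%:R * (2 ^- k * aM k) = 0.
Proof.
move=> [a0 a1 _ aS] [|[|[|n]]] // _.
  by rewrite !big_ord_recr big_ord0 /= a0 a1.
rewrite big_ord_recr /= binn mul1r (aS n.+3) // big_mkord.
set m := n.+3; have -> : \sum_(k < m) aM k * 'C(m, k)%:R * 2 ^+ (m - k) =
    2 ^+ m * \sum_(k < m) 'C(m, k)%:R * (2 ^- k * aM k).
  rewrite mulr_sumr; apply: eq_bigr => k _.
  have -> : 2 ^+ m = 2 ^+ (m - k) * 2 ^+ k :> rat.
    by rewrite -exprD subnK // ltnW.
  rewrite [_%:R * (_ * _)]mulrCA -[RHS]mulrA mulVKf ?expf_neq0 //.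
  by rewrite [RHS]mulrC [_%:R * _]mulrC.
rewrite ![2 ^- m * _]mulrCA (mulVKf (expf_neq0 _ _)) //.
by move: (\sum_(k < m) _) => S; field.
Qed.

Theorem mainTheorem9 (a : int) (ha : a <= 0)
    (aM : nat -> rat) (haM : is_aM a aM) (d j : nat) (hj : (j <= d)%N) :
  cM aM j d = (-1) ^+ d * cM aM (d - j)%N d.
Proof.
rewrite !cM_umbral ?leq_subr // subKn //.
rewrite -(umbral_reflect _ _ (is_aM_odd _ _ haM)) -linearZ /=.
congr (umbral _ _).
(* The substitution exchanges ['X] and [1 + 'X] up to sign, so the total sign is
   [(-1) ^+ j * (-1) ^+ (d - j)]. *)
rewrite rmorphM !rmorphXn rmorphD rmorph1 /= comp_polyX.
have -> : 1 + (- 1 - 'X) = - 'X :> {poly rat} by ring.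
have -> : - 1 - 'X = - (1 + 'X) :> {poly rat} by ring.
rewrite (exprNn 'X) (exprNn (1 + 'X)) -mul_polyC rmorphXn /= rmorphN1.
have -> : (-1) ^+ d = (-1) ^+ j * (-1) ^+ (d - j) :> {poly rat}.
  by rewrite -exprD subnKC.
by rewrite mulrACA [X in _ * X = _]mulrC.
Qed.
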